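(* (i) Let $n\ge 1$ and let $\mathcal P_1,\ldots,\mathcal P_n$ be ranked posets of the same (finite) rank, each having a unique minimal element and a unique maximal element. If the disjoint union $\bigsqcup_{i=1}^n\mathcal P_i$ is Macaulay, then the wedge product $\bigvee_{i=1}^n\mathcal P_i$ is Macaulay; and if the wedge product $\bigvee_{i=1}^n\mathcal P_i$ is Macaulay, then the diamond product $\Diamond_{i=1}^n\mathcal P_i$ is Macaulay. (ii) Let $\mathcal P$ be a ranked poset of finite rank with a unique minimal element and a unique maximal element, Macaulay with respect to a given total order $\le$, and such that $\nabla_{\mathcal P}(\mathcal P_{[r]})=\mathcal P_{[r+1]}$ for all integers $r\ge 0$. Let $n\ge 2$ and let $\mathcal P_1,\ldots,\mathcal P_n$ be copies of $\mathcal P$, each with the total order $\le$. Then each of the following three statements is equivalent to $\mathcal P$ (with $\le$) being additive: (a) $\bigsqcup_{i=1}^n\mathcal P_i$ is Macaulay with respect to the union simplicial order; (b) $\bigvee_{i=1}^n\mathcal P_i$ is Macaulay with respect to the union simplicial order; (c) $\Diamond_{i=1}^n\mathcal P_i$ is Macaulay with respect to the union simplicial order.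
   Context: A poset $\mathcal P$ is ranked if there is a function $r:\mathcal P\to\mathbb N=\{0,1,2,\dots\}$ such that some minimal element has rank $0$ and $r(b)=r(a)+1$ whenever $b$ covers $a$. The rank of $\mathcal P$ is the largest rank of an element; $\mathcal P_{[d]}$ is the set of elements of rank $d$ (the $d$-th level). Levels are assumed finite. For $A\subseteq\mathcal P$ the upper shadow is $\nabla_{\mathcal P}A=\{b\in\mathcal P: b\text{ covers some }a\in A\}$. Given an additional total order on $\mathcal P$ (not required to be related to the partial order), $\mathrm{Seg}_d\,q$ is the set of the $q$ largest elements of $\mathcal P_{[d]}$ in the total order (the initial segment of size $q$ in level $d$). $\mathcal P$ is Macaulay with respect to the total order if for every $d$ and every $A\subseteq\mathcal P_{[d]}$: (1) $|\nabla_{\mathcal P}\mathrm{Seg}_d|A||\le|\nabla_{\mathcal P}A|$, and (2) $\nabla_{\mathcal P}\mathrm{Seg}_d|A|=\mathrm{Seg}_{d+1}|\nabla_{\mathcal P}\mathrm{Seg}_d|A||$. $\mathcal P$ is Macaulay if such a total order exists. A segment is a set $A$ of elements of one level such that whenever $a,b\in A$, $c$ is in the same level and $a>c>b$ in the total order, then $c\in A$. A final segment consists of the smallest $q$ elements of a level for some $q$. For a segment $A$ in a level, let $B$ be the set of elements of that level larger than all elements of $A$; the new shadow is $\nabla_{\mathrm{new}}(A)=\nabla(A)\setminus\nabla(B)$. A Macaulay poset with its total order is additive if, within each level: whenever $A$ is an initial segment and $B$ a segment with $|A|=|B|$, $|\nabla_{\mathrm{new}}(A)|\ge|\nabla_{\mathrm{new}}(B)|$;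 and whenever $B$ is a segment and $C$ a final segment with $|B|=|C|$, $|\nabla_{\mathrm{new}}(B)|\ge|\nabla_{\mathrm{new}}(C)|$. The disjoint union $\bigsqcup\mathcal P_i$ has $a\le b$ iff $a,b$ lie in the same $\mathcal P_i$ and $a\le b$ there. The wedge product $\bigvee\mathcal P_i$ (for posets with unique least elements $\ell_i$) is the disjoint union with all $\ell_i$ identified to one element. The diamond product $\Diamond\mathcal P_i$ (for ranked posets of the same rank with unique least elements $\ell_i$ and unique largest elements $L_i$) is the disjoint union with all $\ell_i$ identified to one element and all $L_i$ identified to another element. In the last two, $a\le b$ iff $a\le b$ in some $\mathcal P_i$. Ranks are inherited from the $\mathcal P_i$. Union simplicial order on $\mathcal P_1\sqcup\mathcal P_2$, given total orders $\le_1,\le_2$: elements of smaller rank are smaller; for equal rank, every element of $\mathcal P_1$ is smaller than every element of $\mathcal P_2$, and two elements of the same $\mathcal P_i$ are compared by $\le_i$. For $n$ posets it is defined inductively, and it induces total orders on wedge and diamond products, also called union simplicial. *)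

(* Defs.v *)
From HB Require Import structures.
From mathcomp Require Import all_boot all_order.
From mathcomp Require Import generic_quotient.

Set Implicit Arguments.
Unset Strict Implicit.
Unset Printing Implicit Defensive.

Import Order.TTheory.
Local Open Scope order_scope.
Local Open Scope quotient_scope.

Section RankedPosets.
Variables (d : Order.disp_t) (T : finPOrderType d).
Implicit Types (x y a b c : T) (A B C : {set T}).

Definition minimal x : bool := [forall y, (y <= x) ==> (y == x)].
Definition maximal x : bool := [forall y, (x <= y) ==> (y == x)].
Definition covers b a : bool := (a < b) && [forall c, ~~ ((a < c) && (c < b))].

Definition rank_function (r : T -> nat) : Prop :=
  (exists2 x, minimal x & r x = 0%N) /\
  (forall a b, covers b a -> r b = (r a).+1).

Definition poset_rank (r : T -> nat) : nat := \max_(x : T) r x.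

Definition level (r : T -> nat) (k : nat) : {set T} := [set x | r x == k].

Definition shadow A : {set T} := [set b | [exists a in A, covers b a]].

Definition total_order (le : rel T) : Prop :=
  [/\ total le, antisymmetric le & transitive le].

(* The q largest elements of level k for the total order le: those having     *)
(* fewer than q strictly larger elements in that level.                       *)
Definition seg (r : T -> nat) (le : rel T) (k q : nat) : {set T} :=
  [set x in level r k |
    (#|[set y in level r k | le x y && (y != x)]| < q)%N].

Definition macaulay_wrt (r : T -> nat) (le : rel T) : Prop :=
  total_order le /\
  forall (k : nat) A, A \subset level r k ->
    (#|shadow (seg r le k #|A|)| <= #|shadow A|)%N /\
    shadow (seg r le k #|A|) =
      seg r le k.+1 #|shadow (seg r le k #|A|)|.

Definition macaulay (r : T -> nat) : Prop :=
  exists le : rel T, macaulay_wrt r le.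

Definition segment (r : T -> nat) (le : rel T) (k : nat) A : Prop :=
  A \subset level r k /\
  forall a b c, a \in A -> b \in A -> c \in level r k ->
    le c a && (c != a) -> le b c && (b != c) -> c \in A.

Definition initial_segment (r : T -> nat) (le : rel T) (k : nat) A : Prop :=
  exists q, A = seg r le k q.

Definition final_segment (r : T -> nat) (le : rel T) (k : nat) A : Prop :=
  exists q, A = seg r (fun x y => le y x) k q.

Definition new_shadow (r : T -> nat) (le : rel T) (k : nat) A : {set T} :=
  shadow A :\:
  shadow [set b in level r k | [forall a in A, le a b && (a != b)]].

Definition macaulay_additive (r : T -> nat) (le : rel T) : Prop :=
  [/\ macaulay_wrt r le,
      forall k A B,
        initial_segment r le k A -> segment r le k B -> #|A| = #|B| ->
        (#|new_shadow r le k B| <= #|new_shadow r le k A|)%N &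
      forall k B C,
        segment r le k B -> final_segment r le k C -> #|B| = #|C| ->
        (#|new_shadow r le k C| <= #|new_shadow r le k B|)%N].

Lemma minimalP x : reflect (forall y, y <= x -> y = x) (minimal x).
Proof.
apply: (iffP forallP) => h y; first by move=> yx; apply/eqP/(implyP (h y)).
by apply/implyP => /h ->.
Qed.

Lemma maximalP x : reflect (forall y, x <= y -> y = x) (maximal x).
Proof.
apply: (iffP forallP) => h y; first by move=> yx; apply/eqP/(implyP (h y)).
by apply/implyP => /h ->.
Qed.

Lemma exists_minimal_le x : exists2 m, minimal m & m <= x.
Proof.
have [n] := ubnP #|[set y | y < x]|; elim: n x => // n IHn x.
rewrite ltnS => cx.
case: (boolP (minimal x)) => [mx|]; first by exists x.
rewrite negb_forall => /existsP[y]; rewrite negb_imply => /andP[yx ney].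
have ltyx : y < x by rewrite lt_neqAle ney.
have [|m mm my] := IHn y; last by exists m => //; apply: le_trans yx.
apply: leq_trans cx; apply: proper_card; apply/properP; split.
  by apply/subsetP => z; rewrite !inE => /lt_trans; apply.
by exists y; rewrite !inE ?ltxx.
Qed.

Lemma exists_maximal_ge x : exists2 m, maximal m & x <= m.
Proof.
have [n] := ubnP #|[set y | x < y]|; elim: n x => // n IHn x.
rewrite ltnS => cx.
case: (boolP (maximal x)) => [mx|]; first by exists x.
rewrite negb_forall => /existsP[y]; rewrite negb_imply => /andP[xy ney].
have ltxy : x < y by rewrite lt_neqAle eq_sym ney.
have [|m mm my] := IHn y; last by exists m => //; apply: le_trans my.
apply: leq_trans cx; apply: proper_card; apply/properP; split.
  by apply/subsetP => z; rewrite !inE; apply: lt_trans.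
by exists y; rewrite !inE ?ltxx.
Qed.

Lemma exists_cover x y : x < y -> exists2 c, covers c x & c <= y.
Proof.
move=> xy; pose Q c := (x < c) && (c <= y).
have Qy : Q y by rewrite /Q xy lexx.
case: (arg_minnP (fun c => #|[set z | x < z & z < c]|) Qy).
move=> c /andP[xc cy] cmin; exists c => //; rewrite /covers xc /=.
apply/forallP => z; apply/negP => /andP[xz zc].
have /cmin : Q z by rewrite /Q xz (le_trans (ltW zc)).
apply/negP; rewrite -ltnNge; apply: proper_card; apply/properP; split.
  apply/subsetP => t; rewrite !inE => /andP[-> tz].
  exact: lt_trans zc.
by exists z; rewrite !inE ?xz ?zc // ltxx andbF.
Qed.

Lemma rank_le r x y : rank_function r -> x <= y -> (r x <= r y)%N.
Proof.
case=> _ rS; have [n] := ubnP #|[set z | x < z]|; elim: n x => // n IHn x.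
rewrite ltnS => cx; rewrite le_eqVlt => /predU1P[->//|/exists_cover[c cov cy]].
have xc : x < c by case/andP: cov.
rewrite ltnW // -(rS _ _ cov); apply: IHn cy.
apply: leq_trans cx; apply: proper_card; apply/properP; split.
  by apply/subsetP => z; rewrite !inE; apply: lt_trans.
by exists c; rewrite !inE ?ltxx.
Qed.

End RankedPosets.

(* A fresh name for the sigma type: {i : 'I_n & P i} itself canonically       *)
(* carries the lexicographic order, in which components are comparable.       *)
Definition disjoint_union (d : Order.disp_t) (n : nat)
  (P : 'I_n -> finPOrderType d) : Type := {i : 'I_n & P i}.

Section Products.
Variables (d : Order.disp_t) (n : nat) (P : 'I_n -> finPOrderType d).

Local Notation U := (disjoint_union P).

HB.instance Definition _ := Finite.copy U {i : 'I_n & P i}.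

Definition inU (i : 'I_n) (x : P i) : U := existT (fun i => P i : Type) i x.

Definition du_le (x y : U) : bool :=
  (tag x == tag y) && (tagged x <= tagged_as x y).

Lemma du_leP x y :
  reflect (exists i, exists x' y' : P i,
             [/\ x = inU x', y = inU y' & x' <= y'])
          (du_le x y).
Proof.
apply: (iffP idP) => [|[i [x' [y' [-> -> le_xy]]]]]; last first.
  by rewrite /du_le /= eqxx tagged_asE.
case: x y => [i x] [j y]; rewrite /du_le /= => /andP[/eqP eij].
by case: _ / eij y => y; rewrite tagged_asE => le_xy; exists i, x, y.
Qed.

Fact du_le_refl : reflexive du_le.
Proof. by case=> i x; rewrite /du_le /= eqxx tagged_asE lexx. Qed.

Fact du_le_anti : antisymmetric du_le.
Proof.
move=> [i x] [j y]; rewrite /du_le /= => /andP[/andP[/eqP eij]].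
by case: _ / eij y => y; rewrite eqxx /= !tagged_asE => xy yx;
  rewrite (@le_anti _ _ x y) // xy.
Qed.

Fact du_le_trans : transitive du_le.
Proof.
move=> [j y] [i x] [k z]; rewrite /du_le /= => /andP[/eqP eij].
case: _ / eij y => y; rewrite !tagged_asE => xy /andP[/eqP eik].
by case: _ / eik z => z; rewrite !tagged_asE eqxx => /(le_trans xy).
Qed.

HB.instance Definition _ :=
  Order.Le_isPOrder.Build d U du_le_refl du_le_anti du_le_trans.

(* The wedge product: all minimal elements of the components (the l_i, when   *)
(* each component has a unique one) are identified.                           *)
Definition wedge_rel (x y : U) : bool :=
  (x == y) || (minimal (tagged x) && minimal (tagged y)).

Fact wedge_rel_equiv : equiv_class_of wedge_rel.
Proof.
split=> [x|x y|y x z]; rewrite /wedge_rel ?eqxx //.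
  by rewrite eq_sym andbC.
case: eqVneq => [->//|_] /= /andP[mx my].
by case: eqVneq => [<-|_] /=; rewrite ?mx ?my ?orbT //= => ->; rewrite orbT.
Qed.
Canonical wedge_equiv := EquivRelPack wedge_rel_equiv.

(* The diamond product: moreover all maximal elements are identified.  When   *)
(* the components are single points, l_i = L_i and everything is identified.  *)
Definition diamond_rel (x y : U) : bool :=
  [|| x == y, minimal (tagged x) && minimal (tagged y) |
      [&& ~~ minimal (tagged x), ~~ minimal (tagged y),
          maximal (tagged x) & maximal (tagged y)]].

Fact diamond_rel_equiv : equiv_class_of diamond_rel.
Proof.
split=> [x|x y|y x z]; rewrite /diamond_rel ?eqxx //.
  rewrite eq_sym andbC; congr [|| _, _ | _].
  by do 4!case: (_ (tagged _)).
case: (eqVneq y x) => [->//|_]; case: (eqVneq y z) => [<-|_].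
  by move=> /= ->; rewrite orbT.
move: (minimal (tagged x)) (minimal (tagged y)) (minimal (tagged z)).
move: (maximal (tagged x)) (maximal (tagged y)) (maximal (tagged z)).
by do 6!case; rewrite ?orbT.
Qed.
Canonical diamond_equiv := EquivRelPack diamond_rel_equiv.

Lemma quot_enum (e : equiv_rel U) (Q : eqQuotType e) :
  undup [seq \pi_Q x | x <- enum {: U}] =i predT.
Proof.
by move=> a; rewrite mem_undup -[a](reprK (qT := Q)) map_f ?mem_enum.
Qed.

Definition wedge : Type := {eq_quot wedge_equiv}.
HB.instance Definition _ := EqQuotient.on wedge.
HB.instance Definition _ := Countable.on wedge.
HB.instance Definition _ := isFinite.Build wedge
  (Finite.uniq_enumP (undup_uniq _) (@quot_enum _ wedge)).

Definition diamond : Type := {eq_quot diamond_equiv}.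
HB.instance Definition _ := EqQuotient.on diamond.
HB.instance Definition _ := Countable.on diamond.
HB.instance Definition _ := isFinite.Build diamond
  (Finite.uniq_enumP (undup_uniq _) (@quot_enum _ diamond)).

(* a <= b iff x <= y for some representatives x of a and y of b lying in one  *)
(* and the same component, see du_leP.                                        *)
Definition quot_le (e : equiv_rel U) (Q : eqQuotType e) (a b : Q) : bool :=
  [exists x : U, [exists y : U,
     [&& \pi_Q x == a, \pi_Q y == b & x <= y]]].

Lemma quot_leP (e : equiv_rel U) (Q : eqQuotType e) (a b : Q) :
  reflect (exists x y : U, [/\ \pi_Q x = a, \pi_Q y = b & x <= y])
          (quot_le a b).
Proof.
apply: (iffP existsP) => [[x /existsP[y /and3P[/eqP xa /eqP yb xy]]]|].
  by exists x, y.
case=> x [y [xa yb xy]]; exists x; apply/existsP; exists y.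
by rewrite xa yb !eqxx.
Qed.

Lemma quot_le_refl (e : equiv_rel U) (Q : eqQuotType e) :
  reflexive (@quot_le e Q).
Proof.
by move=> a; apply/quot_leP; exists (repr a), (repr a); rewrite reprK lexx.
Qed.

Lemma minimal_du (x y : U) : x <= y -> minimal (tagged y) -> x = y.
Proof.
by move=> /du_leP[i [x' [y' [-> -> le_xy]]]] /minimalP /(_ _ le_xy) ->.
Qed.

Lemma maximal_du (x y : U) : x <= y -> maximal (tagged x) -> y = x.
Proof.
by move=> /du_leP[i [x' [y' [-> -> le_xy]]]] /maximalP /(_ _ le_xy) ->.
Qed.

Lemma minimal_below (x : U) : exists2 m : U, minimal (tagged m) & m <= x.
Proof.
case: x => i x; have [m mm mx] := exists_minimal_le x.
by exists (inU m) => //; apply/du_leP; exists i, m, x.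
Qed.

Lemma maximal_above (x : U) : exists2 m : U, maximal (tagged m) & x <= m.
Proof.
case: x => i x; have [m mm mx] := exists_maximal_ge x.
by exists (inU m) => //; apply/du_leP; exists i, x, m.
Qed.

Lemma eq_wedge (x y : U) : (\pi_wedge x = \pi_wedge y) <-> wedge_rel x y.
Proof. by split=> [|h]; [move/eqmodP | apply/eqmodP]. Qed.

Lemma eq_diamond (x y : U) :
  (\pi_diamond x = \pi_diamond y) <-> diamond_rel x y.
Proof. by split=> [|h]; [move/eqmodP | apply/eqmodP]. Qed.

Lemma wedge_le_anti : antisymmetric (@quot_le _ wedge).
Proof.
move=> a b /andP[/quot_leP[x [y [<- <- xy]]] /quot_leP[y' [x' [yy xx yx]]]].
apply/eq_wedge; move/eq_wedge: yy; move/eq_wedge: xx.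
case/orP=> [/eqP exx|/andP[mx' mx]]; case/orP=> [/eqP eyy|/andP[my' my]].
- by subst; rewrite (@le_anti _ _ x y) ?xy // /wedge_rel eqxx.
- by rewrite (minimal_du xy my) /wedge_rel eqxx.
- have my : minimal (tagged y) by rewrite -eyy (minimal_du yx mx').
  by rewrite /wedge_rel mx my orbT.
- by rewrite /wedge_rel mx my orbT.
Qed.

Lemma wedge_le_trans : transitive (@quot_le _ wedge).
Proof.
move=> b a c /quot_leP[x [y [<- <- xy]]] /quot_leP[y' [z [yy <- yz]]].
apply/quot_leP; move/eq_wedge: yy => /orP[/eqP eyy|/andP[my' my]].
  by exists x, z; split=> //; apply: le_trans yz; rewrite eyy.
have [m mm mz] := minimal_below z; exists m, z; split=> //.
by apply/eq_wedge; rewrite (minimal_du xy my) /wedge_rel mm my orbT.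
Qed.

HB.instance Definition _ := Order.Le_isPOrder.Build d wedge
  (@quot_le_refl _ wedge) wedge_le_anti wedge_le_trans.

Lemma diamond_le_anti : antisymmetric (@quot_le _ diamond).
Proof.
move=> a b /andP[/quot_leP[x [y [<- <- xy]]] /quot_leP[y' [x' [yy xx yx]]]].
apply/eq_diamond; move/eq_diamond: yy; move/eq_diamond: xx.
case/or3P=> [/eqP exx|/andP[mx' mx]|/and4P[nx' nx Mx' Mx]]; last first.
- by rewrite (maximal_du xy Mx) /diamond_rel eqxx.
- have eyx := minimal_du yx mx'; subst x'.
  case/or3P=> [/eqP <-|/andP[_ my]|/and4P[]]; last by rewrite mx'.
    by rewrite /diamond_rel mx mx' orbT.
  by rewrite /diamond_rel mx my orbT.
case/or3P=> [/eqP eyy|/andP[my' my]|/and4P[ny' ny My' My]].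
- by subst; rewrite (@le_anti _ _ x y) ?xy // /diamond_rel eqxx.
- by rewrite (minimal_du xy my) /diamond_rel eqxx.
- rewrite -exx (maximal_du yx My') /diamond_rel.
  by rewrite ny' ny My' My !orbT.
Qed.

Lemma diamond_le_trans : transitive (@quot_le _ diamond).
Proof.
move=> b a c /quot_leP[x [y [<- <- xy]]] /quot_leP[y' [z [yy <- yz]]].
apply/quot_leP; move/eq_diamond: (yy).
case/or3P=> [/eqP eyy|/andP[my' my]|/and4P[_ _ My' _]].
- by exists x, z; split=> //; apply: le_trans yz; rewrite eyy.
- have [m mm mz] := minimal_below z; exists m, z; split=> //.
  by apply/eq_diamond; rewrite (minimal_du xy my) /diamond_rel mm my orbT.
- by exists x, y; rewrite (maximal_du yz My').
Qed.

HB.instance Definition _ := Order.Le_isPOrder.Build d diamond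
  (@quot_le_refl _ diamond) diamond_le_anti diamond_le_trans.

Section Ranks.
Variable r : forall i, P i -> nat.

Definition du_rank (x : U) : nat := r (tagged x).

(* When the components have unique minimal and maximal elements and a common  *)
(* rank, the rank does not depend on the representative: see wedge_rank_pi    *)
(* and diamond_rank_pi.                                                       *)
Definition wedge_rank (a : wedge) : nat := du_rank (repr a).
Definition diamond_rank (a : diamond) : nat := du_rank (repr a).

Hypothesis r_rank : forall i, rank_function (@r i).
Hypothesis r_eq : forall i j, poset_rank (@r i) = poset_rank (@r j).
Hypothesis P_min : forall i, exists! x : P i, minimal x.
Hypothesis P_max : forall i, exists! x : P i, maximal x.

Lemma du_rank_minimal (x : U) : minimal (tagged x) -> du_rank x = 0%N.
Proof.
case: x => i x /= mx; rewrite /du_rank /=; have [[m mm rm] _] := r_rank i.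
by have [l [_ ul]] := P_min i; rewrite -(ul x mx) (ul m mm).
Qed.

Lemma du_rank_maximal (x : U) :
  maximal (tagged x) -> du_rank x = poset_rank (@r (tag x)).
Proof.
case: x => i x /= mx; rewrite /du_rank /=; apply/eqP.
rewrite eqn_leq (leq_bigmax x) /=; apply/bigmax_leqP => y _.
have [m mm ym] := exists_maximal_ge y; have [L [_ uL]] := P_max i.
by rewrite -(uL x mx) (uL m mm) rank_le.
Qed.

Lemma wedge_rank_pi (x : U) : wedge_rank (\pi x) = du_rank x.
Proof.
rewrite /wedge_rank; have /eq_wedge := reprK (\pi_wedge x).
by case/orP=> [/eqP->//|/andP[mx my]]; rewrite !du_rank_minimal.
Qed.

Lemma diamond_rank_pi (x : U) : diamond_rank (\pi x) = du_rank x.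
Proof.
rewrite /diamond_rank; have /eq_diamond := reprK (\pi_diamond x).
case/or3P=> [/eqP->//|/andP[mx my]|/and4P[_ _ Mx My]].
  by rewrite !du_rank_minimal.
by rewrite !du_rank_maximal.
Qed.

End Ranks.

(* Elements of smaller rank are smaller; inside a level, the components are   *)
(* put one after the other in the order of their indices.                     *)
Definition du_simplicial (r : forall i, P i -> nat)
    (le : forall i, rel (P i)) : rel U :=
  fun x y =>
    (du_rank r x < du_rank r y)%N ||
    (du_rank r x == du_rank r y) &&
      ((tag x < tag y)%N ||
       (tag x == tag y) && le (tag x) (tagged x) (tagged_as x y)).

Definition wedge_simplicial (r : forall i, P i -> nat)
    (le : forall i, rel (P i)) : rel wedge :=
  fun a b => du_simplicial r le (repr a) (repr b).

Definition diamond_simplicial (r : forall i, P i -> nat)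
    (le : forall i, rel (P i)) : rel diamond :=
  fun a b => du_simplicial r le (repr a) (repr b).

End Products.

(* Main.v *)
(* Write s(q) for the size of the upper shadow of the q largest elements of    *)
(* level k, and N for the size of that level. The new shadow of the segment    *)
(* occupying positions p, ..., p + b - 1 has s(p + b) - s(p) elements, so that *)
(* additivity in level k amounts to                                            *)
(*      s(a + b) + s(a + b - N) <= s(a) + s(b)   for a, b <= N,                *)
(* with truncated subtraction and s constant from N on. An initial segment of  *)
(* size q in the union of n copies has a shadow of size sum_(j < n) s(q - jN), *)
(* so the displayed inequality is the Macaulay inequality for a set that is an *)
(* initial segment in each of two copies; conversely, iterating it gives the   *)
(* Macaulay inequality for every set. The union, the wedge and the diamond     *)
(* differ only in level 0 and in the top level. Where this matters, every      *)
(* nonempty set has the whole next level as its shadow, in the wedge (level 0) *)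
(* and in the diamond and in each component (level 0, and from the next-to-top *)
(* level on), so both the Macaulay property and the inequality are automatic.  *)

Require Import Defs.
From mathcomp Require Import all_boot all_order.
From mathcomp Require Import generic_quotient zify.
Import Order.TTheory.
Local Open Scope order_scope.
Local Open Scope quotient_scope.

Set Implicit Arguments.
Unset Strict Implicit.
Unset Printing Implicit Defensive.

(** Both Macaulay conditions for subsets of level k ([macaulay_at]) involve only levels k and k + 1.
    The projections from the disjoint union to the wedge and the diamond preserve ranks, every cover
    in a quotient comes from a cover in the union ([quot_covers]), and on levels where nothing is
    identified they are bijections; there the conditions carry over ([quot_macaulay_at]). The other
    levels of the quotient are flat ([flat_at]), hence Macaulay for any total order
    ([flat_macaulay_at]). This gives (i), with the total order pulled back along representatives.

    For (ii), additivity is [subadditive_at] in every level ([additive_atP]). If a set A in n copies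
    has slices of sizes a_i, its shadow has at least the sum of the s(a_i) elements, since P is
    Macaulay; [stack_sum] bounds this sum below by the shadow size of an initial segment of size
    |A|, and [stack_minn] shows that this shadow is again an initial segment ([copies_macaulay_at]).
    Conversely, two initial segments placed in two copies return the inequality
    ([copies_subadditive_at]). In flat levels of P the inequality holds anyway, so the middle
    levels, common to all three products, decide additivity ([additive_of_middle_levels]). *)

Section Positions.
Variables (d : Order.disp_t) (T : finPOrderType d) (r : T -> nat).
Implicit Types (x y : T) (A B : {set T}) (le : rel T) (k p q : nat).

(** * Positions in a level, segments and new shadows *)

Definition position le k x := #|[set y in level r k | le x y && (y != x)]|.

Lemma in_seg le k q x : (x \in seg r le k q) = (r x == k) && (position le k x < q)%N.
Proof. by rewrite !inE. Qed.

Lemma in_level k x : (x \in level r k) = (r x == k).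
Proof. by rewrite inE. Qed.

Lemma seg_sub le k q : seg r le k q \subset level r k.
Proof. by apply/subsetP => x; rewrite in_seg inE => /andP[]. Qed.

Lemma seg0 le k : seg r le k 0 = set0.
Proof. by apply/setP => x; rewrite in_seg ltn0 andbF inE. Qed.

Lemma seg_subset le k p q : (p <= q)%N -> seg r le k p \subset seg r le k q.
Proof.
move=> pq; apply/subsetP => x; rewrite !in_seg => /andP[->] /=.
by move/leq_trans; apply.
Qed.

Lemma shadowS A B : A \subset B -> shadow A \subset shadow B.
Proof.
move=> /subsetP AB; apply/subsetP => x; rewrite !inE => /exists_inP[a /AB aB ca].
by apply/exists_inP; exists a.
Qed.

Lemma shadow0 : shadow (set0 : {set T}) = set0.
Proof. by apply/setP => x; rewrite !inE; apply/exists_inP => -[a]; rewrite inE. Qed.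

Lemma shadowU A B : shadow (A :|: B) = shadow A :|: shadow B.
Proof.
apply/eqP; rewrite eqEsubset subUset !shadowS ?subsetUl ?subsetUr // !andbT.
apply/subsetP => x; rewrite !inE => /exists_inP[a]; rewrite inE => /orP[] aA c.
  by apply/orP; left; apply/exists_inP; exists a.
by apply/orP; right; apply/exists_inP; exists a.
Qed.

Variables (le : rel T) (k : nat).
Hypothesis le_tot : total_order le.

Local Notation N := #|level r k|.
Local Notation pos := (position le k).
Local Notation seg := (seg r le k).

Let letot : total le. Proof. by case: le_tot. Qed.
Let leanti : antisymmetric le. Proof. by case: le_tot. Qed.
Let letrans : transitive le. Proof. by case: le_tot. Qed.

Lemma pos_lt x y : x \in level r k -> y \in level r k ->
  (pos x < pos y)%N = le y x && (y != x).
Proof.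
have lt_pos u v : u \in level r k -> le v u -> u != v -> (pos u < pos v)%N.
  move=> uk vu nuv; apply: proper_card; apply/properP; split.
    apply/subsetP => z; rewrite !inE => /and3P[-> uz nzu] /=.
    rewrite (letrans vu uz) /=; apply: contraNneq nuv => ezv; subst z.
    by apply/eqP/leanti; rewrite uz vu.
  by exists u; rewrite !inE ?eqxx ?andbF // vu nuv; move: uk; rewrite inE => ->.
move=> xk yk; apply/idP/andP => [lt|[yx]]; last by rewrite eq_sym; apply: lt_pos.
have [exy|nxy] := eqVneq x y; first by rewrite exy ltnn in lt.
split=> //.
case/orP: (letot y x) => // xy.
by have := lt_pos _ _ yk xy; rewrite eq_sym => /(_ nxy); lia.
Qed.

Lemma pos_inj : {in level r k &, injective pos}.
Proof.
move=> x y xk yk exy; have [//|nxy] := eqVneq x y.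
have := pos_lt yk xk; have := pos_lt xk yk; rewrite exy ltnn (eq_sym y) nxy !andbT.
by have := letot x y => /orP[] ->.
Qed.

Lemma pos_bound x : x \in level r k -> (pos x < N)%N.
Proof.
move=> xk; apply: proper_card; apply/properP; split.
  by apply/subsetP => z; rewrite !inE => /andP[].
by exists x; rewrite // !inE eqxx !andbF.
Qed.

(** Positions are distinct and below N, so by counting they exhaust 0, ..., N - 1; segments thereby
    become intervals of numbers. *)
Lemma perm_pos : perm_eq [seq pos x | x <- enum (level r k)] (iota 0 N).
Proof.
have uq : uniq [seq pos x | x <- enum (level r k)].
  rewrite map_inj_in_uniq ?enum_uniq // => x y; rewrite !mem_enum.
  exact: pos_inj.
have [||_ h] := uniq_min_size uq (s2 := iota 0 N).
- by move=> _ /mapP[x + ->]; rewrite mem_enum mem_iota => /pos_bound.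
- by rewrite size_iota size_map -cardE.
- by rewrite uniq_perm ?iota_uniq.
Qed.

Lemma pos_onto p : (p < N)%N -> exists2 x, x \in level r k & pos x = p.
Proof.
move=> pN; have : p \in iota 0 N by rewrite mem_iota.
rewrite -(perm_mem perm_pos) => /mapP[x + ->].
by rewrite mem_enum; exists x.
Qed.

Lemma card_seg q : #|seg q| = minn q N.
Proof.
have -> : #|seg q| = count (fun x => (pos x < q)%N) (enum (level r k)).
  rewrite -size_filter cardE; apply/perm_size/uniq_perm.
  - exact: enum_uniq.
  - exact/filter_uniq/enum_uniq.
  by move=> x; rewrite mem_enum [RHS]mem_filter mem_enum in_seg inE andbC.
rewrite -(count_map pos (fun i => i < q)%N) (permP perm_pos).
suff h m n : count (fun i => (i < q)%N) (iota m n) = minn (q - m) n by rewrite h subn0.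
by elim: n m => [|n IHn] m /=; rewrite ?IHn; lia.
Qed.

Lemma seg_full q : (N <= q)%N -> seg q = level r k.
Proof.
by move=> Nq; apply/eqP; rewrite eqEcard seg_sub card_seg; lia.
Qed.

Definition shadow_size q := #|shadow (seg q)|.

Lemma shadow_size0 : shadow_size 0 = 0.
Proof. by rewrite /shadow_size seg0 shadow0 cards0. Qed.

Lemma shadow_size_full q : (N <= q)%N -> shadow_size q = #|shadow (level r k)|.
Proof. by move=> Nq; rewrite /shadow_size seg_full. Qed.

Lemma new_shadow0 : new_shadow r le k set0 = set0.
Proof. by rewrite /new_shadow shadow0 set0D. Qed.

(** The elements at positions p, ..., p + b - 1. Every nonempty segment has this form
    ([segment_slab]); initial segments have p = 0 and final ones p = N - b. *)
Definition slab p b := seg (p + b) :\: seg p.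

Lemma in_slab p b x :
  (x \in slab p b) = [&& r x == k, (p <= pos x)%N & (pos x < p + b)%N].
Proof. by rewrite inE !in_seg; case: eqP => //= _; rewrite -leqNgt. Qed.

Lemma slab_level p b x : x \in slab p b -> x \in level r k.
Proof. by rewrite in_slab inE => /andP[]. Qed.

Lemma card_slab p b : (p + b <= N)%N -> #|slab p b| = b.
Proof.
by move=> pbN; rewrite cardsDS ?seg_subset ?leq_addr // !card_seg; lia.
Qed.

Lemma card_new_shadow_slab p b : (0 < b)%N -> (p + b <= N)%N ->
  #|new_shadow r le k (slab p b)| = shadow_size (p + b) - shadow_size p.
Proof.
move=> b0 pbN; rewrite /new_shadow.
have -> : [set y in level r k | [forall a in slab p b, le a y && (a != y)]] = seg p.
  apply/setP => y; rewrite in_seg !inE; case: (eqVneq (r y) k) => //= yk.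
  have {}yk : y \in level r k by rewrite inE yk.
  apply/forall_inP/idP => [h|yp a aB].
    (* As b > 0, the slab contains the element at position p, and being larger than it means having
       position below p. *)
    have [|a ak ap] := @pos_onto p; first by lia.
    rewrite -ap pos_lt // h // in_slab ap leqnn.
    by move: ak; rewrite inE => ->; lia.
  rewrite -pos_lt ?(slab_level aB) //.
  by move: aB; rewrite in_slab => /and3P[_ /(leq_trans yp)].
have sub : seg p \subset seg (p + b) by rewrite seg_subset ?leq_addr.
rewrite -cardsDS ?shadowS //; congr #|pred_of_set _|.
have -> : seg (p + b) = slab p b :|: seg p.
  apply/setP => x; rewrite in_setU in_slab !in_seg.
  by case: eqP => //= _; case: ltnP; lia.
by rewrite shadowU setDUl setDv setU0.
Qed.

Lemma slab_segment p b : segment r le k (slab p b).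
Proof.
split=> [|a1 a2 c a1B a2B ck]; first by apply/subsetP => x /slab_level.
rewrite -!pos_lt ?(slab_level a1B) ?(slab_level a2B) //.
move: a1B a2B; rewrite !in_slab; move: ck; rewrite inE => ->; lia.
Qed.

Lemma segment_slab B : segment r le k B -> B != set0 ->
  exists2 p, (p + #|B| <= N)%N & B = slab p #|B|.
Proof.
move=> [/subsetP Bk Bseg] /set0Pn[x0 x0B].
case: (arg_minnP (P := mem B) pos x0B) => x1 x1B min1.
case: (arg_maxnP (P := mem B) pos x0B) => x2 x2B max2.
have le12 := min1 _ x2B; have lt2 := pos_bound (Bk _ x2B).
have eB : B = slab (pos x1) ((pos x2).+1 - pos x1).
  apply/setP => y; rewrite in_slab; apply/idP/and3P => [yB|[yk y1 y2]].
    have := Bk _ yB; rewrite inE => ->; have := min1 _ yB; have := max2 _ yB.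
    by rewrite /=; split=> //; lia.
  have {}yk : y \in level r k by rewrite inE.
  (* The two ends are treated apart because [segment] only concerns elements strictly between two
     members. *)
  have [-> //|n1] := eqVneq y x1; have [-> //|n2] := eqVneq y x2.
  have np u : u \in B -> y != u -> pos u != pos y.
    by move=> uB; apply: contraNneq => /esym /(pos_inj yk (Bk _ uB)) ->.
  have := np _ x1B n1; have := np _ x2B n2 => ? ?.
  by apply: (Bseg _ _ _ x1B x2B yk); rewrite -pos_lt ?(Bk _ x1B) ?(Bk _ x2B) //; lia.
exists (pos x1); first by rewrite {1}eB card_slab; lia.
by rewrite {2}eB card_slab //; lia.
Qed.

Lemma initial_segment_slab A : initial_segment r le k A -> A = slab 0 #|A|.
Proof.
case=> q ->; apply/setP => x; rewrite in_slab in_seg card_seg /= add0n leq_min.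
by case: eqP => //= /eqP xk; rewrite (pos_bound (x := x)) ?inE ?andbT.
Qed.

Lemma slab_initial_segment b : initial_segment r le k (slab 0 b).
Proof. by exists b; rewrite /slab seg0 setD0. Qed.

(** Every element of the level is larger than x, smaller than x, or x itself. *)
Lemma pos_rev x : x \in level r k ->
  (position (fun x y => le y x) k x + (pos x).+1 = N)%N.
Proof.
move=> xk; rewrite -(cardsID [set y | le x y && (y != x)] (level r k)) addnC addSn.
rewrite -addnS; congr (_ + _)%N.
  by apply: eq_card => y; rewrite !inE.
rewrite [in RHS](cardsD1 x) !inE eqxx andbF /= -in_level xk.
rewrite add1n; congr _.+1; apply: eq_card => y; rewrite !inE.
have [->|nyx] := eqVneq y x; first by rewrite !andbF.
have nle2 : ~~ (le x y && le y x) by apply: contraNN nyx => /leanti ->.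
by move: (letot x y) nle2; case: (le x y); case: (le y x); case: (r y == k).
Qed.

Lemma final_segmentP A : final_segment r le k A <-> A = slab (N - #|A|) #|A|.
Proof.
have revE q : Defs.seg r (fun x y => le y x) k q = slab (N - minn q N) (minn q N).
  apply/setP => x; rewrite in_seg in_slab; case: (eqVneq (r x) k) => //= /eqP xk.
  have {}xk : x \in level r k by rewrite inE.
  have := pos_rev xk; have := pos_bound xk.
  by move: (position _ k x) (position le k x) #|level r k| => u v n; lia.
split=> [[q ->]|eA]; first by rewrite revE card_slab //; lia.
exists #|A|; rewrite revE (minn_idPl _) //.
by rewrite subset_leq_card // eA; apply/subsetP => x /slab_level.
Qed.

(** One inequality for both halves of additivity. If a + b <= N, the second term vanishes and the
    bound is s(a + b) - s(b) <= s(a): initial segments are best. Otherwise it reads s(N) - s(a) <=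
    s(b) - s(a + b - N): final segments are worst. *)
Definition subadditive_at := forall a b, (a <= N)%N -> (b <= N)%N ->
  (shadow_size (a + b) + shadow_size (a + b - N) <= shadow_size a + shadow_size b)%N.

Definition additive_at :=
  (forall A B, initial_segment r le k A -> segment r le k B -> #|A| = #|B| ->
     (#|new_shadow r le k B| <= #|new_shadow r le k A|)%N) /\
  (forall B C, segment r le k B -> final_segment r le k C -> #|B| = #|C| ->
     (#|new_shadow r le k C| <= #|new_shadow r le k B|)%N).

Lemma shadow_sizeS p q : (p <= q)%N -> (shadow_size p <= shadow_size q)%N.
Proof. by move=> pq; apply/subset_leq_card/shadowS/seg_subset. Qed.

Lemma additive_atP : additive_at <-> subadditive_at.
Proof.
split=> [[h1 h2] a b aN bN|h]; last first.
  split=> [A B iA sB eAB|B C sB fC eBC].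
    have [B0|Bn0] := eqVneq B set0; first by rewrite B0 new_shadow0 cards0.
    have [p pN eB] := segment_slab sB Bn0; have B0 : (0 < #|B|)%N by rewrite card_gt0.
    rewrite (initial_segment_slab iA) {1}eB eAB !card_new_shadow_slab //; last by lia.
    have : (shadow_size (p + #|B|) <= shadow_size p + shadow_size #|B|)%N.
      apply: leq_trans (leq_addr _ _) (h p #|B| _ _); lia.
    rewrite add0n shadow_size0; lia.
  have [C0|Cn0] := eqVneq C set0; first by rewrite C0 new_shadow0 cards0.
  have C0 : (0 < #|C|)%N by rewrite card_gt0.
  have [|p pN eB] := segment_slab sB; first by rewrite -card_gt0 eBC.
  move/final_segmentP: fC => eC; have CN : (#|C| <= N)%N by lia.
  rewrite {1}eC {1}eB eBC !card_new_shadow_slab //; try lia.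
  (* For these arguments the sum is N + p, so the inequality becomes s(N) + s(p) <= s(N - |C|) + s(p
     + |C|). *)
  have := h (N - #|C|)%N (p + #|C|)%N; rewrite subnK //.
  rewrite (_ : N - #|C| + (p + #|C|) = N + p)%N; last by lia.
  rewrite addKn (shadow_size_full (leqnn N)) (shadow_size_full (leq_addr p N)).
  rewrite leq_subr -eBC pN => /(_ isT isT); lia.
have [abN|Nab] := leqP (a + b) N.
  rewrite (_ : a + b - N = 0)%N ?shadow_size0 ?addn0; last by lia.
  have [->|a0] := posnP a; first by rewrite add0n leq_addl.
  have := h1 (slab 0 a) (slab b a) (slab_initial_segment _) (slab_segment _ _).
  have ba : (b + a <= N)%N by rewrite addnC.
  rewrite !card_slab // => /(_ erefl).
  rewrite !card_new_shadow_slab // add0n shadow_size0 [(b + a)%N]addnC; lia.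
have [->|na] := eqVneq a N.
  by rewrite addKn (shadow_size_full (leqnn N)) (shadow_size_full (leq_addr b N)).
(* The final segment at positions a, ..., N - 1 is compared with the segment of the same size c at
   positions p, ..., b - 1. *)
pose c := (N - a)%N; pose p := (a + b - N)%N.
have acN : (a + c = N)%N by rewrite subnKC.
have pcb : (p + c = b)%N by rewrite /c /p; lia.
have c0 : (0 < c)%N by rewrite /c; lia.
have := h2 (slab p c) (slab a c) (slab_segment _ _).
rewrite final_segmentP !card_slab ?acN ?pcb //.
rewrite -[X in slab (X - _)]acN addnK => /(_ erefl erefl).
rewrite !card_new_shadow_slab ?acN ?pcb // (shadow_size_full (ltnW Nab)).
have sa := shadow_sizeS aN; have sp : (shadow_size p <= shadow_size b)%N.
  by apply: shadow_sizeS; lia.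
rewrite (shadow_size_full (leqnn N)) -/p in sa *; lia.
Qed.

Definition macaulay_at := forall A, A \subset level r k ->
  (#|shadow (seg #|A|)| <= #|shadow A|)%N /\
  shadow (seg #|A|) = Defs.seg r le k.+1 #|shadow (seg #|A|)|.

Definition flat_at := forall A, A \subset level r k -> A != set0 ->
  shadow A = level r k.+1.

End Positions.

(** * Flat levels *)

Section Flat.
Variables (d : Order.disp_t) (T : finPOrderType d) (r : T -> nat).
Variables (le : rel T) (k : nat).
Hypotheses (le_tot : total_order le) (flat : flat_at r k).

Let s_flat q : (0 < q)%N -> (0 < #|level r k|)%N ->
  shadow (seg r le k q) = level r k.+1.
Proof.
move=> q0 N0; apply: flat; first exact: seg_sub.
by rewrite -card_gt0 card_seg // leq_min q0.
Qed.

Lemma flat_macaulay_at : macaulay_at r le k.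
Proof.
move=> A Ak; have [->|An0] := eqVneq A set0.
  by rewrite cards0 seg0 shadow0 cards0 leqnn [RHS]seg0.
have A0 : (0 < #|A|)%N by rewrite card_gt0.
rewrite (flat Ak An0) s_flat ?leqnn // ?(leq_trans A0) ?subset_leq_card //.
by rewrite [RHS]seg_full.
Qed.

(** For a, b > 0 the values s(a), s(b) and s(a + b) all equal the size of the next level, and s(a +
    b - N) is that size or 0. *)
Lemma flat_subadditive_at : subadditive_at r le k.
Proof.
move=> a b aN bN.
have [->|a0] := posnP a.
  by rewrite add0n (eqP bN) !shadow_size0 addn0.
have [->|b0] := posnP b.
  by rewrite addn0 (eqP aN) !shadow_size0.
have N0 := leq_trans a0 aN; rewrite {3 4}/shadow_size !s_flat // leq_add //.
  by rewrite /shadow_size s_flat // ltn_addr.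
have [->|c0] := posnP (a + b - #|level r k|); first by rewrite shadow_size0.
by rewrite /shadow_size s_flat.
Qed.

End Flat.

(** * Flatness at the bottom and at the top of a ranked poset *)

Section Ranked.
Variables (d : Order.disp_t) (T : finPOrderType d) (r : T -> nat).
Hypothesis rT : rank_function r.
Implicit Types x y : T.

Lemma rank_lt x y : x < y -> (r x < r y)%N.
Proof.
case/exists_cover => c cx cy; have [_ /(_ _ _ cx) rc] := rT.
by rewrite -rc rank_le.
Qed.

Lemma rank0_minimal x : r x = 0%N -> minimal x.
Proof.
move=> rx; apply/minimalP => y; rewrite le_eqVlt => /predU1P[//|/rank_lt].
by rewrite rx.
Qed.

Lemma lt_rank_covers x y : x < y -> r y = (r x).+1 -> covers y x.
Proof.
move=> xy ry; case/exists_cover: (xy) => c cx; rewrite le_eqVlt => /predU1P[<- //|].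
by have [_ /(_ _ _ cx) rc] := rT => /rank_lt; rewrite ry rc ltnn.
Qed.

Lemma rank_le_poset_rank x : (r x <= poset_rank r)%N.
Proof. exact: leq_bigmax. Qed.

Lemma shadow_level k (A : {set T}) :
  A \subset level r k -> shadow A \subset level r k.+1.
Proof.
move=> /subsetP Ak; apply/subsetP => b; rewrite !inE => /exists_inP[a /Ak].
by rewrite inE => /eqP <- /(proj2 rT) ->.
Qed.

(** Elements of rank 0 are minimal, so level 0 holds only the unique minimal element, which lies
    below everything. *)
Lemma flat_level0 :
  (forall x y, minimal x -> minimal y -> x = y) -> flat_at r 0.
Proof.
move=> umin A A0 /set0Pn[a aA]; apply/eqP; rewrite eqEsubset shadow_level //=.
apply/subsetP => b; rewrite !inE => /eqP rb; apply/exists_inP; exists a => //.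
have := subsetP A0 _ aA; rewrite inE => /eqP ra.
apply: lt_rank_covers; rewrite ?ra // lt_neqAle.
apply/andP; split; first by apply: contra_eq_neq rb => <-; rewrite ra.
have [m mm mb] := exists_minimal_le b.
by rewrite (umin a m) // rank0_minimal.
Qed.

(** An element of level k + 1, if there is one, has the top rank; it is then the unique maximal
    element, which lies above everything. *)
Lemma flat_level_top k : (forall x y, maximal x -> maximal y -> x = y) ->
  (poset_rank r <= k.+1)%N -> flat_at r k.
Proof.
move=> umax rk A Ak /set0Pn[a aA]; apply/eqP; rewrite eqEsubset shadow_level //=.
apply/subsetP => b; rewrite !inE => /eqP rb; apply/exists_inP; exists a => //.
have := subsetP Ak _ aA; rewrite inE => /eqP ra.
apply: lt_rank_covers; rewrite ?ra // lt_neqAle.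
apply/andP; split; first by apply: contra_eq_neq rb => <-; rewrite ra; lia.
have [m mm am] := exists_maximal_ge a; rewrite (umax b m) //.
apply/maximalP => y; rewrite le_eqVlt => /predU1P[//|/rank_lt].
by have := rank_le_poset_rank y; lia.
Qed.

End Ranked.

(** * Transfer along rank-preserving quotient maps *)

Section QuotientMap.
Variables (d : Order.disp_t) (S T : finPOrderType d) (f : S -> T).
Variables (rS : S -> nat) (rT : T -> nat).
Hypothesis f_le : forall a b : T,
  a <= b <-> exists x y : S, [/\ f x = a, f y = b & x <= y].
Hypothesis f_rank : forall x, rT (f x) = rS x.
Hypothesis rS_rank : rank_function rS.

Lemma quot_lt x y : x < y -> f x < f y.
Proof.
move=> xy; rewrite lt_neqAle; apply/andP; split; last first.
  by apply/f_le; exists x, y; rewrite ltW.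
apply: contraTneq (rank_lt rS_rank xy) => /(congr1 rT).
by rewrite !f_rank => ->; rewrite ltnn.
Qed.

Lemma quot_lt_inv a b : a < b -> exists x y : S, [/\ f x = a, f y = b & x < y].
Proof.
move=> ab; have /f_le[x [y [xa yb xy]]] := ltW ab; exists x, y; split=> //.
by rewrite lt_neqAle xy andbT; apply: contraTneq ab => exy; rewrite -xa -yb exy ltxx.
Qed.

(** The image of a cover is a cover because an element strictly between would have rank strictly
    between two consecutive integers, whichever representatives witness the two inequalities. *)
Lemma quot_covers a b :
  covers b a <-> exists x y : S, [/\ f x = a, f y = b & covers y x].
Proof.
split=> [/andP[ab /forallP nab]|[x [y [<- <- cyx]]]].
  have [x [y [xa yb /exists_cover[c cx cy]]]] := quot_lt_inv ab.
  exists x, c; split=> //; have /andP[xc _] := cx.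
  have := nab (f c); rewrite -{1}xa quot_lt //=.
  rewrite lt_neqAle -yb negb_and negbK => /orP[/eqP //|/negP[]].
  by apply/f_le; exists c, y.
have /andP[xy _] := cyx; have [_ /(_ _ _ cyx) rxy] := rS_rank.
apply/andP; split; first exact: quot_lt.
apply/forallP => c; apply/negP => /andP[].
move=> /quot_lt_inv[x1 [c1 [ex1 ec1 /(rank_lt rS_rank)]]].
move=> /[swap] /quot_lt_inv[c2 [y2 [ec2 ey2 /(rank_lt rS_rank)]]].
have := congr1 rT ex1; have := congr1 rT ec1; have := congr1 rT ec2.
by have := congr1 rT ey2; rewrite !f_rank; lia.
Qed.

Lemma quot_rank_function : rank_function rT.
Proof.
have [[m mm rm] rS1] := rS_rank; split.
  exists (f m); last by rewrite f_rank.
  apply/minimalP => b; rewrite le_eqVlt => /predU1P[//|].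
  case/quot_lt_inv => x [y [_ ey /(rank_lt rS_rank)]].
  by rewrite -[rS y]f_rank ey f_rank rm.
move=> a b /quot_covers[x [y [<- <- /rS1]]].
by rewrite !f_rank.
Qed.

Lemma quot_surj b : exists x, f x = b.
Proof. by have /f_le[x [y [ex _ _]]] := lexx b; exists x. Qed.

Section Level.
Variables (leS : rel S) (leT : rel T) (k : nat).
Hypothesis f_inj : forall j, (j == k) || (j == k.+1) ->
  {in level rS j &, injective f}.
Hypothesis f_mono : forall j, (j == k) || (j == k.+1) ->
  {in level rS j &, {mono f : x y / leS x y >-> leT x y}}.

Let k_k : (k == k) || (k == k.+1). Proof. by rewrite eqxx. Qed.
Let k_k1 : (k.+1 == k) || (k.+1 == k.+1). Proof. by rewrite eqxx orbT. Qed.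

Lemma shadow_imset (A : {set S}) : A \subset level rS k ->
  shadow (f @: A) = f @: shadow A.
Proof.
move=> /subsetP Ak; apply/setP => b; rewrite inE.
apply/exists_inP/imsetP => [[_ /imsetP[a aA ->] /quot_covers]|[y + ->]].
  case=> x [y [exa <- cyx]]; exists y => //; rewrite inE.
  apply/exists_inP; exists a => //.
  (* The cover may start from another representative x of [f a]; its rank puts x in level k, where
     [f] is injective. *)
  have <- // : x = a; apply: (f_inj k_k) => //; last exact: Ak.
  by rewrite inE -f_rank exa f_rank; have := Ak _ aA; rewrite inE.
rewrite inE => /exists_inP[a aA cya]; exists (f a); first exact: imset_f.
by apply/quot_covers; exists a, y.
Qed.

Lemma card_imset_level j (A : {set S}) : (j == k) || (j == k.+1) ->
  A \subset level rS j -> #|f @: A| = #|A|.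
Proof.
move=> jk /subsetP Aj; rewrite card_in_imset // => x y /Aj ? /Aj.
exact: f_inj.
Qed.

Lemma imset_level_inj j (A B : {set S}) : (j == k) || (j == k.+1) ->
  A \subset level rS j -> B \subset level rS j -> f @: A = f @: B -> A = B.
Proof.
move=> jk.
have sub (C D : {set S}) : C \subset level rS j -> D \subset level rS j ->
    f @: C = f @: D -> C \subset D.
  move=> /subsetP Cj /subsetP Dj eCD; apply/subsetP => x xC.
  have /imsetP[y yD exy] : f x \in f @: D by rewrite -eCD imset_f.
  by rewrite (f_inj jk (Cj _ xC) (Dj _ yD) exy).
move=> Aj Bj eAB; have AB := sub _ _ Aj Bj eAB; have BA := sub _ _ Bj Aj (esym eAB).
by apply/eqP; rewrite eqEsubset AB BA.
Qed.

Lemma seg_imset j q : (j == k) || (j == k.+1) ->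
  seg rT leT j q = f @: seg rS leS j q.
Proof.
move=> jk.
have pos_f x : x \in level rS j -> position rT leT j (f x) = position rS leS j x.
  move=> xj; rewrite {2}/position -(card_imset_level jk); last first.
    by apply/subsetP => y; rewrite !inE => /andP[].
  apply: eq_card => b; rewrite !inE; apply/andP/imsetP => [[+ +]|[y]].
    have [y <-] := quot_surj b; rewrite f_rank => yj /andP[xy nxy].
    have {}yj : y \in level rS j by rewrite inE.
    exists y => //; rewrite !inE -in_level yj -(f_mono jk) // xy.
    by apply: contra_neq nxy => ->.
  rewrite !inE => /and3P[yj xy nyx] ->; rewrite f_rank; split=> //.
  have {}yj : y \in level rS j by rewrite inE.
  by rewrite (f_mono jk) // xy; apply: contra_neq nyx; apply: (f_inj jk).
apply/setP => b; rewrite in_seg; apply/andP/imsetP => [|[x]].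
  have [x <-] := quot_surj b; rewrite f_rank => -[xj].
  by rewrite pos_f ?inE // => xq; exists x; rewrite // in_seg xj.
rewrite in_seg => /andP[xj xq] ->; rewrite f_rank xj; split=> //.
by rewrite pos_f // inE.
Qed.

(** The subsets of level k of [T] are the images of those of [S], and taking images preserves sizes,
    shadows and initial segments. *)
Lemma quot_macaulay_at : macaulay_at rS leS k <-> macaulay_at rT leT k.
Proof.
have condE (A : {set S}) : A \subset level rS k ->
    ((#|shadow (seg rS leS k #|A|)| <= #|shadow A|)%N /\
      shadow (seg rS leS k #|A|) =
        seg rS leS k.+1 #|shadow (seg rS leS k #|A|)|) <->
    ((#|shadow (seg rT leT k #|f @: A|)| <= #|shadow (f @: A)|)%N /\
      shadow (seg rT leT k #|f @: A|) =
        seg rT leT k.+1 #|shadow (seg rT leT k #|f @: A|)|).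
  move=> Ak; rewrite (card_imset_level k_k) // !seg_imset // !shadow_imset ?seg_sub //.
  rewrite !(card_imset_level k_k1) ?shadow_level ?seg_sub //.
  split=> -[-> e]; split=> //; first by rewrite -e.
  by apply: (imset_level_inj k_k1) e; rewrite ?seg_sub ?shadow_level ?seg_sub.
split=> [mS B Bk|mT A Ak].
  have eB : f @: (f @^-1: B :&: level rS k) = B.
    apply/setP => b; apply/imsetP/idP => [[x + ->]|bB]; first by rewrite !inE => /andP[].
    have [x exb] := quot_surj b; exists x => //.
    by rewrite !inE exb bB -f_rank exb; have := subsetP Bk _ bB; rewrite inE.
  by rewrite -eB; apply/condE; [exact: subsetIr|apply: mS; exact: subsetIr].
apply/condE => //; apply: mT; apply/subsetP => _ /imsetP[x /(subsetP Ak) + ->].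
by rewrite !inE f_rank.
Qed.

End Level.
End QuotientMap.

(** * Disjoint unions and the union simplicial order *)

Section DisjointUnion.
Variables (d : Order.disp_t) (n : nat) (P : 'I_n -> finPOrderType d).
Variables (r : forall i, P i -> nat).
Hypothesis r_rank : forall i, rank_function (@r i).
Local Notation U := (disjoint_union P).
Implicit Types (i j : 'I_n) (A B : {set U}) (x y : U).

Definition slice i A : {set P i} := [set x | inU x \in A].

Lemma mem_slice i (x : P i) A : (x \in slice i A) = (inU x \in A).
Proof. by rewrite inE. Qed.

Lemma eq_slice A B : (forall i, slice i A = slice i B) -> A = B.
Proof. by move=> e; apply/setP => -[i x]; have := mem_slice x A; rewrite e mem_slice. Qed.

Lemma card_slice A : #|A| = \sum_i #|slice i A|.
Proof.
transitivity (\sum_i \sum_(x : P i | inU x \in A) 1)%N; last first.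
  by apply: eq_bigr => i _; rewrite -sum1dep_card.
rewrite -sum1_card (sig_big_dep (fun=> true)
  (fun i (x : P i) => inU x \in A) (fun _ _ => 1%N)) /=.
by apply: eq_bigl => -[i x].
Qed.

Lemma inU_le i (x y : P i) : (inU x <= inU y) = (x <= y).
Proof. by rewrite /Order.le /= /du_le /= eqxx tagged_asE. Qed.

Lemma inU_lt i (x y : P i) : (inU x < inU y) = (x < y).
Proof. by rewrite !lt_leAnge !inU_le. Qed.

Lemma inU_covers i (x y : P i) : covers (inU y) (inU x) = covers y x.
Proof.
rewrite /covers inU_lt; congr (_ && _); apply/forallP/forallP => h c.
  by have := h (inU c); rewrite !inU_lt.
apply/negP => /andP[xc cy]; have := ltW xc => /du_leP[j [x' [c' [ex ec _]]]].
have eij : i = j by have := congr1 (@tag _ _) ex.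
subst j c; move: xc cy; rewrite !inU_lt => xc cy.
by have := h c'; rewrite xc cy.
Qed.

Lemma slice_shadow i A : slice i (shadow A) = shadow (slice i A).
Proof.
apply/setP => b; rewrite !inE; apply/exists_inP/exists_inP => [[a aA c]|[a]].
  have /andP[ab _] := c; have := ltW ab => /du_leP[j [a' [b' [ea eb _]]]].
  have eij : i = j by have := congr1 (@tag _ _) eb.
  by subst j a; exists a'; [rewrite inE | rewrite -inU_covers].
by rewrite inE => aA c; exists (inU a); rewrite ?inU_covers.
Qed.

Lemma du_rank_function (i0 : 'I_n) : rank_function (du_rank r).
Proof.
have [[m mm rm] _] := r_rank i0; split.
  exists (inU m) => //; apply/minimalP => y /du_leP[j [y' [m' [ey em le_ym]]]].
  have eij : i0 = j by have := congr1 (@tag _ _) em.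
  subst j y; rewrite -inU_le -em inU_le in le_ym.
  by rewrite (minimalP _ mm _ le_ym).
move=> a b c; have /andP[ab _] := c; have := ltW ab => /du_leP[j [a' [b' [ea eb _]]]].
by subst a b; move: c; rewrite inU_covers; case: (r_rank j) => _; apply.
Qed.

Variable le : forall i, rel (P i).
Hypothesis le_tot : forall i, total_order (@le i).
Local Notation leU := (du_simplicial r le).

Lemma du_simplicial_same i (x y : P i) :
  leU (inU x) (inU y) = (r x < r y)%N || (r x == r y) && le x y.
Proof. by rewrite /du_simplicial /= ltnn eqxx tagged_asE. Qed.

Lemma du_simplicial_diff i j (x : P i) (y : P j) : i != j ->
  leU (inU x) (inU y) = (r x < r y)%N || (r x == r y) && (i < j)%N.
Proof. by move=> nij; rewrite /du_simplicial /= (negbTE nij) orbF. Qed.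

Lemma du_simplicial_total_order : total_order leU.
Proof.
split.
- move=> [i x] [j y]; have [tot _ _] := le_tot i.
  have [eij|nij] := eqVneq i j.
    subst j; rewrite !du_simplicial_same.
    by case: ltngtP => //= _; apply: tot.
  rewrite !du_simplicial_diff // 1?eq_sym //.
  by case: ltngtP => //= _; case: ltngtP => // /val_inj eij; rewrite eij eqxx in nij.
- move=> [i x] [j y]; have [_ anti _] := le_tot i.
  have [eij|nij] := eqVneq i j.
    subst j; rewrite !du_simplicial_same.
    by case: ltngtP => //= _ /anti ->.
  rewrite !du_simplicial_diff // 1?eq_sym //.
  by case: ltngtP => //= _; case: ltngtP.
move=> [j y] [i x] [l z]; have [_ _ trans] := le_tot i.
rewrite /du_simplicial /= => /orP[lxy|/andP[/eqP exy hxy]].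
  case/orP=> [lyz|/andP[/eqP <- _]]; rewrite ?lxy //.
  by rewrite (ltn_trans lxy lyz).
case/orP=> [lyz|/andP[/eqP eyz hyz]].
  by rewrite /du_rank /= in exy lyz *; rewrite exy lyz.
apply/orP; right; rewrite exy eyz eqxx /=.
case/orP: hxy => [ij|/andP[/eqP eij hxy]].
  case/orP: hyz => [jl|/andP[/eqP ejl _]]; first by rewrite (ltn_trans ij jl).
  by subst l; rewrite ij.
case/orP: hyz => [jl|/andP[/eqP ejl hyz]]; first by subst j; rewrite jl.
subst j; subst l; rewrite !tagged_asE in hxy hyz *.
by rewrite eqxx (trans _ _ _ hxy hyz) orbT.
Qed.

(** The larger elements of the level are the whole level in each component of higher index, and
    those larger within the component of x. *)
Lemma du_position i (x : P i) :
  position (du_rank r) leU (r x) (inU x) =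
  (\sum_(j : 'I_n | (i < j)%N) #|level (@r j) (r x)| + position (@r i) (@le i) (r x) x)%N.
Proof.
rewrite {1}/position card_slice (bigID (fun j : 'I_n => (i < j)%N)) /=; congr (_ + _)%N.
  apply: eq_bigr => j ij; apply: eq_card => y; rewrite !inE.
  have nij : i != j by apply: contraTneq ij => ->; rewrite ltnn.
  rewrite du_simplicial_diff // ij /du_rank /=.
  case: eqVneq => //= ->; rewrite ltnn ?eqxx /=.
  by apply: contraTneq nij => /(congr1 (@tag _ _)) /= ->; rewrite negbK.
rewrite (bigD1 i) ?ltnn //= [X in (_ + X)%N]big1 ?addn0 => [|j /andP[nij nji]].
  apply: eq_card => y; rewrite !inE du_simplicial_same /du_rank /=.
  case: eqVneq => //= ->; rewrite ltnn ?eqxx /=; congr (_ && ~~ _).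
  by rewrite -tag_eqE /tag_eq /= eqxx tagged_asE.
apply: eq_card0 => y; rewrite !inE du_simplicial_diff 1?eq_sym // /du_rank /=.
by case: eqVneq => //= ->; rewrite ltnn ?eqxx /= (negbTE nij).
Qed.

Lemma slice_seg i k q :
  slice i (seg (du_rank r) leU k q) =
  seg (@r i) (@le i) k (q - \sum_(j : 'I_n | (i < j)%N) #|level (@r j) k|).
Proof.
apply/setP => x; rewrite mem_slice !in_seg /du_rank /=.
by case: eqVneq => //= <-; rewrite du_position ltn_subRL.
Qed.

End DisjointUnion.

(** * The numerical inequality for several copies *)

Section StackedSums.
Variables (s : nat -> nat) (N : nat).
Hypotheses (s_zero : s 0 = 0%N) (s_sat : forall q, (N <= q)%N -> s q = s N).

Definition stack n m := (\sum_(j < n) s (m - j * N))%N.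

Lemma stackS n m : stack n.+1 m = (s m + stack n (m - N))%N.
Proof.
rewrite /stack big_ord_recl mul0n subn0; congr (_ + _)%N.
by apply: eq_bigr => j _; rewrite mulSn subnDA.
Qed.

Lemma stack0 n : stack n 0 = 0%N.
Proof. by rewrite /stack big1. Qed.

(** Pouring [stack n m] units into successive blocks of capacity s(N) leaves s(m - jN) in block j:
    blocks already exhausted by m are full, at most one is partly filled, the rest are empty. *)
Lemma stack_minn n j m : (forall q, s q <= s N)%N -> (j < n)%N ->
  minn (stack n m - j * s N) (s N) = s (m - j * N).
Proof.
move=> s_le; elim: n j m => // n IHn [|j] m jn; rewrite stackS.
  rewrite mul0n !subn0; have [Nm|mN] := leqP N m; first by rewrite (s_sat Nm); lia.
  by rewrite (_ : m - N = 0)%N ?stack0 ?addn0; [apply/minn_idPl | lia].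
have [Nm|mN] := leqP N m.
  by rewrite (s_sat Nm) !mulSn subnDl subnDA IHn.
rewrite (_ : m - N = 0)%N ?stack0 ?addn0; last by lia.
rewrite !mulSn !subnDA (_ : m - N = 0)%N ?sub0n ?s_zero; last by lia.
by rewrite (_ : s m - s N = 0)%N ?sub0n ?min0n //; apply/eqP/s_le.
Qed.

Hypothesis s_sub : forall a b, (a <= N)%N -> (b <= N)%N ->
  (s (a + b) + s (a + b - N) <= s a + s b)%N.

(** If m >= N, a full block s(N) cancels on both sides and induction applies; if m < N, at most two
    terms survive on the left and [s_sub] is the claim. *)
Lemma stack_add n a m : (a <= N)%N -> (m <= n * N)%N ->
  (stack n.+1 (a + m) <= s a + stack n m)%N.
Proof.
move=> aN; elim: n m => [|n IHn] m mn.
  by rewrite (_ : m = 0)%N ?addn0 1?stackS /stack ?big_ord0 //; lia.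
rewrite stackS [stack n.+1 m]stackS; have [Nm|mN] := leqP N m.
  rewrite (s_sat Nm) (s_sat (leq_trans Nm (leq_addl _ _))) addnCA leq_add2l.
  by rewrite -addnBA // IHn //; lia.
rewrite (_ : m - N = 0)%N; last by lia.
rewrite stackS (_ : a + m - N - N = 0)%N ?stack0 ?addn0; last by lia.
exact: s_sub aN (ltnW mN).
Qed.

Lemma stack_sum n (a : 'I_n -> nat) : (forall i, a i <= N)%N ->
  (stack n (\sum_i a i) <= \sum_i s (a i))%N.
Proof.
elim: n a => [|n IHn] a aN; first by rewrite /stack !big_ord0.
rewrite !big_ord_recl; apply: leq_trans (stack_add (aN _) _) _.
  rewrite -[leqRHS](_ : \sum_(i < n) N = _)%N ?leq_sum //.
  by rewrite sum_nat_const card_ord.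
by rewrite leq_add2l IHn.
Qed.

End StackedSums.

Lemma seg_minn (d : Order.disp_t) (T : finPOrderType d) (r : T -> nat)
    (le : rel T) k q : total_order le ->
  seg r le k (minn q #|level r k|) = seg r le k q.
Proof. by move=> tot; case: (leqP q #|level r k|) => // /ltnW qN; rewrite !seg_full. Qed.

Lemma macaulay_at_shadow_seg (d : Order.disp_t) (T : finPOrderType d)
    (r : T -> nat) (le : rel T) k q : total_order le -> macaulay_at r le k ->
  shadow (seg r le k q) = seg r le k.+1 (shadow_size r le k q).
Proof.
move=> tot mac; have [_] := mac _ (seg_sub r le k q).
by rewrite card_seg // seg_minn.
Qed.

(** * Copies of one poset, level by level *)

Section Copies.
Variables (d : Order.disp_t) (P : finPOrderType d) (r : P -> nat) (le : rel P).
Variables (n k : nat).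
Hypotheses (r_rank : rank_function r) (le_tot : total_order le).
Let Ps := fun _ : 'I_n => P.
Let rs := fun _ : 'I_n => r.
Let les := fun _ : 'I_n => le.
Local Notation U := (disjoint_union Ps).
Local Notation rU := (du_rank (P := Ps) rs).
Local Notation leU := (du_simplicial (P := Ps) rs les).
Local Notation N := #|level r k|.
Local Notation s := (shadow_size r le k).

Lemma slice_seg_copies (i : 'I_n) j q :
  slice i (seg rU leU j q) = seg r le j (q - (n - i.+1) * #|level r j|).
Proof.
rewrite (@slice_seg _ _ Ps rs les); congr (seg _ _ _ (_ - _)).
transitivity (\sum_(i.+1 <= l < n) #|level r j|)%N; last exact: sum_nat_const_nat.
by rewrite big_geq_mkord.
Qed.

Lemma card_shadow_seg_copies q : #|shadow (seg rU leU k q)| = stack s N n q.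
Proof.
(* The copy of highest index is filled first, hence the reversal. *)
rewrite card_slice /stack (reindex_inj rev_ord_inj) /=.
apply: eq_bigr => i _; rewrite slice_shadow slice_seg_copies /=.
by rewrite (_ : n - (n - i.+1).+1 = i)%N //; have := ltn_ord i; lia.
Qed.

Lemma shadow_size_sat q : (N <= q)%N -> s q = s N.
Proof. by move=> Nq; rewrite !shadow_size_full. Qed.

Lemma copies_macaulay_at : shadow (level r k) = level r k.+1 ->
  macaulay_at r le k -> subadditive_at r le k -> macaulay_at rU leU k.
Proof.
move=> full mac sub A Ak; rewrite card_shadow_seg_copies.
have Aik i : slice i A \subset level r k.
  apply/subsetP => x; rewrite mem_slice => /(subsetP Ak).
  by rewrite !in_level.
split.
  rewrite (card_slice A) (card_slice (shadow A)).
  apply: leq_trans (stack_sum (shadow_size0 _ _ _) shadow_size_sat sub _) _.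
    by move=> i; apply: subset_leq_card.
  by apply: leq_sum => i _; rewrite slice_shadow; have [] := mac _ (Aik i).
(* Because the full level shadows the full next level, the block size in level k + 1 is s(N), as
   [stack_minn] requires. *)
have sM : s N = #|level r k.+1| by rewrite shadow_size_full // full.
apply: eq_slice => i; rewrite slice_shadow !slice_seg_copies.
rewrite -[RHS]seg_minn // -sM stack_minn ?shadow_size0 //.
- exact: macaulay_at_shadow_seg.
- exact: shadow_size_sat.
- move=> q; have [qN|Nq] := leqP q N; first exact: shadow_sizeS.
  by rewrite shadow_size_sat // ltnW.
by have := ltn_ord i; lia.
Qed.

Lemma copies_subadditive_at : (1 < n)%N ->
  macaulay_at rU leU k -> subadditive_at r le k.
Proof.
move=> n1 mac a b aN bN.
pose i0 : 'I_n := Ordinal (ltnW n1); pose i1 : 'I_n := Ordinal n1.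
(* The test set: initial segments of sizes a and b in two copies, nothing elsewhere. *)
pose B (i : 'I_n) : {set P} :=
  if i == i0 then seg r le k a else if i == i1 then seg r le k b else set0.
pose A : {set U} := [set x | tagged x \in B (tag x)].
have sA i : slice i A = B i by apply/setP => x; rewrite !inE.
have sum2 (F : {set P} -> nat) : F set0 = 0%N ->
    (\sum_i F (B i) = F (seg r le k a) + F (seg r le k b))%N.
  move=> F0; rewrite (bigD1 i0) // (bigD1 i1) //= big1 ?addn0 => [|i /andP[ni0 ni1]].
    by rewrite /B !eqxx.
  by rewrite /B (negbTE ni0) (negbTE ni1).
have Ak : A \subset level rU k.
  apply/subsetP => -[i x]; rewrite !inE /B /du_rank /=.
  by do 2![case: ifP => _; first by rewrite in_seg => /andP[]]; rewrite inE.
have cA : #|A| = (a + b)%N.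
  rewrite card_slice; under eq_bigr => i _ do rewrite sA.
  by rewrite (sum2 (fun X => #|X|)) ?cards0 // !card_seg // !(minn_idPl _).
have [+ _] := mac A Ak; rewrite card_shadow_seg_copies cA.
rewrite (card_slice (shadow A)).
under eq_bigr => i _ do rewrite slice_shadow sA.
rewrite (sum2 (fun X => #|shadow X|)) ?shadow0 ?cards0 //.
(* With n >= 2, the first two terms of the stack are s(a + b) and s(a + b - N); the others are
   dropped. *)
apply: leq_trans; rewrite -(subnK n1) addn2.
by rewrite !stackS ?shadow_size0 // addnA leq_addr.
Qed.

End Copies.

Lemma total_order_comap (S T : Type) (f : S -> T) (leT : rel T) :
  injective f -> total leT -> antisymmetric leT -> transitive leT ->
  [/\ total (relpre f leT), antisymmetric (relpre f leT) & transitive (relpre f leT)].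
Proof.
move=> f_inj tot anti trans; split=> [x y|x y|y x z]; [exact: tot| |exact: trans].
by move=> /anti /f_inj.
Qed.

(** * Wedge and diamond as quotients of the disjoint union *)

Section WedgeDiamond.
Variables (d : Order.disp_t) (n : nat) (P : 'I_n -> finPOrderType d).
Variables (r : forall i, P i -> nat) (i0 : 'I_n).
Hypothesis r_rank : forall i, rank_function (@r i).
Hypothesis r_eq : forall i j, poset_rank (@r i) = poset_rank (@r j).
Hypothesis P_min : forall i, exists! x : P i, minimal x.
Hypothesis P_max : forall i, exists! x : P i, maximal x.
Local Notation U := (disjoint_union P).
Local Notation R := (poset_rank (@r i0)).
Local Notation rU := (du_rank r).
Local Notation W := (wedge P).
Local Notation D := (diamond P).
Implicit Types x y : U.

Let rU_rank : rank_function rU := du_rank_function r_rank i0.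
Let rW_pi x : wedge_rank r (\pi_W x) = rU x := wedge_rank_pi r_rank P_min x.
Let rD_pi x : diamond_rank r (\pi_D x) = rU x :=
  diamond_rank_pi r_rank r_eq P_min P_max x.

Let minimal_rank x : minimal (tagged x) = (rU x == 0%N).
Proof.
apply/idP/eqP; first exact: du_rank_minimal.
exact: (rank0_minimal (r_rank (tag x))).
Qed.

Let maximal_rank x : maximal (tagged x) -> rU x = R.
Proof. by move=> mx; rewrite (du_rank_maximal r_rank P_max mx). Qed.

Let W_le (a b : W) : a <= b <-> exists x y, [/\ \pi_W x = a, \pi_W y = b & x <= y].
Proof. by split=> /quot_leP. Qed.

Let D_le (a b : D) : a <= b <-> exists x y, [/\ \pi_D x = a, \pi_D y = b & x <= y].
Proof. by split=> /quot_leP. Qed.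

Lemma pi_wedge_inj x y : (0 < rU x)%N -> \pi_W x = \pi_W y -> x = y.
Proof.
move=> x0 /eq_wedge /orP[/eqP //|/andP[]].
by rewrite minimal_rank eqn0Ngt x0.
Qed.

Lemma pi_diamond_inj x y : (0 < rU x < R)%N -> \pi_D x = \pi_D y -> x = y.
Proof.
move=> /andP[x0 xR] /eq_diamond /or3P[/eqP //|/andP[]|/and4P[_ _ /maximal_rank xE]].
  by rewrite minimal_rank eqn0Ngt x0.
by rewrite xE ltnn in xR.
Qed.

Lemma wedge_rank_function : rank_function (wedge_rank r).
Proof. exact: quot_rank_function W_le rW_pi rU_rank. Qed.

Lemma diamond_rank_function : rank_function (diamond_rank r).
Proof. exact: quot_rank_function D_le rD_pi rU_rank. Qed.

Lemma wedge_minimal_uniq (a b : W) : minimal a -> minimal b -> a = b.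
Proof.
suff pi_min (c : W) : minimal c -> exists2 m : U, rU m = 0%N & c = \pi_W m.
  move=> /pi_min[x x0 ->] /pi_min[y y0 ->].
  by apply/eq_wedge; rewrite /wedge_rel !minimal_rank x0 y0 orbT.
have [x <-] := quot_surj W_le c => /minimalP cmin.
have [m mm mx] := minimal_below x; exists m; first by apply/eqP; rewrite -minimal_rank.
by symmetry; apply: cmin; apply/W_le; exists m, x.
Qed.

Lemma diamond_minimal_uniq (a b : D) : minimal a -> minimal b -> a = b.
Proof.
suff pi_min (c : D) : minimal c -> exists2 m : U, rU m = 0%N & c = \pi_D m.
  move=> /pi_min[x x0 ->] /pi_min[y y0 ->].
  by apply/eq_diamond; rewrite /diamond_rel !minimal_rank x0 y0 orbT.
have [x <-] := quot_surj D_le c => /minimalP cmin.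
have [m mm mx] := minimal_below x; exists m; first by apply/eqP; rewrite -minimal_rank.
by symmetry; apply: cmin; apply/D_le; exists m, x.
Qed.

Lemma diamond_maximal_uniq (a b : D) : maximal a -> maximal b -> a = b.
Proof.
suff pi_max (c : D) : maximal c -> exists2 m : U, maximal (tagged m) & c = \pi_D m.
  move=> /pi_max[x Mx ->] /pi_max[y My ->].
  apply/eq_diamond; rewrite /diamond_rel !minimal_rank !maximal_rank // Mx My.
  (* In rank 0 the maximal elements are also minimal and are identified as such. *)
  by case: (R == 0%N); rewrite ?orbT.
have [x <-] := quot_surj D_le c => /maximalP cmax.
have [m Mm xm] := maximal_above x; exists m => //.
by symmetry; apply: cmax; apply/D_le; exists x, m.
Qed.

Lemma diamond_poset_rank : (poset_rank (diamond_rank r) <= R)%N.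
Proof.
apply/bigmax_leqP => a _; have [x <-] := quot_surj D_le a; rewrite rD_pi.
by rewrite (r_eq i0 (tag x)); apply: rank_le_poset_rank.
Qed.

Lemma flat_wedge0 : flat_at (wedge_rank r) 0.
Proof. exact: flat_level0 wedge_rank_function wedge_minimal_uniq. Qed.

Lemma flat_diamond (k : nat) : (k == 0) || (R <= k.+1)%N -> flat_at (diamond_rank r) k.
Proof.
case/orP=> [/eqP ->|Rk].
  exact: flat_level0 diamond_rank_function diamond_minimal_uniq.
have Rk' := leq_trans diamond_poset_rank Rk.
exact: (flat_level_top diamond_rank_function diamond_maximal_uniq Rk').
Qed.

Lemma wedge_macaulay_at (leU : rel U) (leW : rel W) k : (0 < k)%N ->
  (forall x y, (0 < rU x)%N -> (0 < rU y)%N -> leU x y = leW (\pi x) (\pi y)) ->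
  macaulay_at rU leU k <-> macaulay_at (wedge_rank r) leW k.
Proof.
move=> k0 leE.
have j0 j : (j == k) || (j == k.+1) -> (0 < j)%N by case/orP => /eqP ->.
apply: (quot_macaulay_at W_le rW_pi rU_rank) => j /j0 {}j0 x y.
  rewrite !in_level => /eqP xj _; apply: pi_wedge_inj; by rewrite xj.
by rewrite !in_level => /eqP xj /eqP yj; rewrite leE ?xj ?yj.
Qed.

(** The bounds on k keep both levels k and k + 1 clear of the identified elements. *)
Lemma diamond_macaulay_at (leU : rel U) (leD : rel D) k :
  (0 < k)%N -> (k.+1 < R)%N ->
  (forall x y, (0 < rU x < R)%N -> (0 < rU y < R)%N ->
    leU x y = leD (\pi x) (\pi y)) ->
  macaulay_at rU leU k <-> macaulay_at (diamond_rank r) leD k.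
Proof.
move=> k0 kR leE.
have jR j : (j == k) || (j == k.+1) -> (0 < j < R)%N.
  by case/orP => /eqP ->; rewrite ?k0 ?kR // ltnW.
apply: (quot_macaulay_at D_le rD_pi rU_rank) => j /jR {}jR x y.
  rewrite !in_level => /eqP xj _; apply: pi_diamond_inj; by rewrite xj.
by rewrite !in_level => /eqP xj /eqP yj; rewrite leE ?xj ?yj.
Qed.

Lemma repr_pi_wedge x : (0 < rU x)%N -> repr (\pi_W x) = x.
Proof. by move=> x0; symmetry; apply: pi_wedge_inj; rewrite ?reprK. Qed.

Lemma repr_pi_diamond x : (0 < rU x < R)%N -> repr (\pi_D x) = x.
Proof. by move=> x0; symmetry; apply: pi_diamond_inj; rewrite ?reprK. Qed.

Lemma macaulay_wedge : macaulay rU -> macaulay (wedge_rank r).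
Proof.
case=> le [[tot anti trans] mac].
have le_tot := total_order_comap (can_inj (@reprK _ W)) tot anti trans.
exists (relpre (@repr _ W) le); split=> // -[|k].
  exact: flat_macaulay_at le_tot flat_wedge0.
apply/(wedge_macaulay_at (leU := le)); last exact: mac; first by [].
by move=> x y x0 y0; rewrite /= !repr_pi_wedge.
Qed.

Lemma macaulay_diamond : macaulay (wedge_rank r) -> macaulay (diamond_rank r).
Proof.
case=> le [[tot anti trans] mac].
have pi_inj : injective (fun a : D => \pi_W (repr a)).
  (* Points identified in the wedge are also identified in the diamond. *)
  move=> a b /eq_wedge abr; rewrite -[a]reprK -[b]reprK; apply/eq_diamond.
  by case/orP: abr => h; rewrite /diamond_rel h ?orbT.
have le_tot := total_order_comap pi_inj tot anti trans.
exists (relpre (fun a : D => \pi_W (repr a)) le); split=> // k.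
have [flat|] := boolP ((k == 0) || (R <= k.+1)%N).
  exact: flat_macaulay_at le_tot (flat_diamond flat).
rewrite negb_or -lt0n -ltnNge => /andP[k0 kR].
(* The middle levels of wedge and diamond are matched through the disjoint union, carrying the wedge
   order pulled back along [\pi]. *)
apply/(diamond_macaulay_at (leU := fun x y => le (\pi x) (\pi y))) => //.
  by move=> x y xR yR; rewrite /= !repr_pi_diamond.
by apply/wedge_macaulay_at; last exact: mac.
Qed.

End WedgeDiamond.

(** * Additivity and the three products of copies *)

Section CopiesUnion.
Variables (d : Order.disp_t) (P : finPOrderType d) (r : P -> nat) (le : rel P).
Variable n : nat.
Hypotheses (r_rank : rank_function r) (P_min : exists! x : P, minimal x).
Hypotheses (P_max : exists! x : P, maximal x) (P_mac : macaulay_wrt r le).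
Hypothesis P_full : forall k, shadow (level r k) = level r k.+1.
Hypothesis n1 : (1 < n)%N.
Let Ps := fun _ : 'I_n => P.
Let rs := fun _ : 'I_n => r.
Let les := fun _ : 'I_n => le.
Local Notation rU := (du_rank (P := Ps) rs).
Local Notation leU := (du_simplicial (P := Ps) rs les).

Let le_tot : total_order le. Proof. by case: P_mac. Qed.
Let i0 : 'I_n := Ordinal (ltnW n1).
Let rs_rank (i : 'I_n) : rank_function (rs i) := r_rank.
Let rs_eq (i j : 'I_n) : poset_rank (rs i) = poset_rank (rs j) := erefl.
Let Ps_min (i : 'I_n) : exists! x : Ps i, minimal x := P_min.
Let Ps_max (i : 'I_n) : exists! x : Ps i, maximal x := P_max.
Let leU_tot : total_order leU := @du_simplicial_total_order _ _ Ps rs les (fun=> le_tot).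

Lemma macaulay_additiveP :
  macaulay_additive r le <-> forall k, subadditive_at r le k.
Proof.
split=> [[_ h1 h2] k|h]; first by apply/additive_atP => //; split; [apply: h1|apply: h2].
by split=> // k; have [] := proj2 (additive_atP r k le_tot) (h k).
Qed.

Lemma du_macaulay_additive :
  macaulay_additive r le -> forall k, macaulay_at rU leU k.
Proof.
move=> /macaulay_additiveP sub k; apply: copies_macaulay_at => //.
by case: P_mac => _; apply.
Qed.

(** The unique minimal and maximal elements make P flat in level 0 and from the next-to-top level
    on, where the inequality is automatic; the remaining levels are handled by
    [copies_subadditive_at]. *)
Lemma additive_of_middle_levels :
  (forall k, (0 < k)%N -> (k.+1 < poset_rank r)%N -> macaulay_at rU leU k) ->
  macaulay_additive r le.
Proof.
have uniqP (Q : pred P) : (exists! x, Q x) -> forall x y, Q x -> Q y -> x = y.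
  by case=> z [_ uz] x y /uz <- /uz.
move=> mac; apply/macaulay_additiveP => k.
have [->|k0] := posnP k.
  exact: flat_subadditive_at le_tot (flat_level0 r_rank (uniqP _ P_min)).
have [kR|Rk] := ltnP k.+1 (poset_rank r).
  by apply: (copies_subadditive_at le_tot n1); apply: mac.
exact: flat_subadditive_at le_tot (flat_level_top r_rank (uniqP _ P_max) Rk).
Qed.

Lemma union_macaulay_iff : macaulay_wrt rU leU <-> macaulay_additive r le.
Proof.
split=> [[_ mac]|/du_macaulay_additive mac]; last by [].
by apply: additive_of_middle_levels => k _ _; apply: mac.
Qed.

Lemma wedge_macaulay_iff :
  macaulay_wrt (wedge_rank (P := Ps) rs) (wedge_simplicial (P := Ps) rs les) <->
  macaulay_additive r le.
Proof.
have leE x y : (0 < rU x)%N -> (0 < rU y)%N ->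
    leU x y = wedge_simplicial (P := Ps) rs les (\pi x) (\pi y).
  by move=> x0 y0; rewrite /wedge_simplicial !(repr_pi_wedge rs_rank Ps_min).
split=> [[_ mac]|/du_macaulay_additive mac].
  apply: additive_of_middle_levels => k k0 _.
  by apply/(wedge_macaulay_at i0 rs_rank Ps_min k0 leE); apply: mac.
have [tot anti trans] := leU_tot.
have tot_wedge : total_order (wedge_simplicial (P := Ps) rs les).
  exact: total_order_comap (can_inj (@reprK _ (wedge Ps))) tot anti trans.
split=> // -[|k].
  exact: flat_macaulay_at tot_wedge (flat_wedge0 i0 rs_rank Ps_min).
by apply/(wedge_macaulay_at i0 rs_rank Ps_min _ leE); last exact: mac.
Qed.

Lemma diamond_macaulay_iff :
  macaulay_wrt (diamond_rank (P := Ps) rs) (diamond_simplicial (P := Ps) rs les) <->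
  macaulay_additive r le.
Proof.
have leE x y : (0 < rU x < poset_rank r)%N -> (0 < rU y < poset_rank r)%N ->
    leU x y = diamond_simplicial (P := Ps) rs les (\pi x) (\pi y).
  move=> x0 y0; rewrite /diamond_simplicial.
  by rewrite !(repr_pi_diamond (i0 := i0) rs_rank rs_eq Ps_min Ps_max).
have macE k (k0 : (0 < k)%N) (kR : (k.+1 < poset_rank r)%N) :=
  diamond_macaulay_at (i0 := i0) rs_rank rs_eq Ps_min Ps_max k0 kR leE.
split=> [[_ mac]|/du_macaulay_additive mac].
  by apply: additive_of_middle_levels => k k0 kR; apply/macE => //; apply: mac.
have [tot anti trans] := leU_tot.
have tot_diamond : total_order (diamond_simplicial (P := Ps) rs les).
  exact: total_order_comap (can_inj (@reprK _ (diamond Ps))) tot anti trans.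
split=> // k; have [flat|] := boolP ((k == 0) || (poset_rank r <= k.+1)%N).
  apply: flat_macaulay_at tot_diamond _.
  exact: (flat_diamond (i0 := i0) rs_rank rs_eq Ps_min Ps_max flat).
rewrite negb_or -lt0n -ltnNge => /andP[k0 kR].
by apply/(macE k k0 kR).
Qed.

End CopiesUnion.

Theorem theorem1 :
  (forall (d : Order.disp_t) (n : nat) (P : 'I_n -> finPOrderType d)
     (r : forall i : 'I_n, P i -> nat),
     (1 <= n)%N ->
     (forall i, rank_function (r i)) ->
     (forall i j, poset_rank (r i) = poset_rank (r j)) ->
     (forall i, exists! x : P i, minimal x) ->
     (forall i, exists! x : P i, maximal x) ->
     (macaulay (du_rank r) -> macaulay (wedge_rank r)) /\
     (macaulay (wedge_rank r) -> macaulay (diamond_rank r))) /\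
  (forall (d : Order.disp_t) (P : finPOrderType d) (r : P -> nat)
     (le : rel P) (n : nat),
     rank_function r ->
     (exists! x : P, minimal x) ->
     (exists! x : P, maximal x) ->
     macaulay_wrt r le ->
     (forall k : nat, shadow (level r k) = level r k.+1) ->
     (2 <= n)%N ->
     let Ps := fun _ : 'I_n => P in
     let rs := fun _ : 'I_n => r in
     let les := fun _ : 'I_n => le in
     (macaulay_wrt (T := disjoint_union Ps) (du_rank rs)
        (du_simplicial rs les) <-> macaulay_additive r le) /\
     (macaulay_wrt (T := wedge Ps) (wedge_rank rs)
        (wedge_simplicial rs les) <-> macaulay_additive r le) /\
     (macaulay_wrt (T := diamond Ps) (diamond_rank rs)
        (diamond_simplicial rs les) <-> macaulay_additive r le)).
Proof.
split=> [d n P r n1 r_rank r_eq P_min P_max|].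
  split; first exact: (macaulay_wedge (Ordinal n1)).
  exact: (macaulay_diamond (Ordinal n1)).
move=> d P r le n r_rank P_min P_max P_mac P_full n1 Ps rs les; split.
  exact: union_macaulay_iff.
split; first exact: wedge_macaulay_iff.
exact: diamond_macaulay_iff.
Qed.
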